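(* Let $(X,\Vert\cdot\vert)$ be an $f$-Banach space and let $K\subset X$ be non-empty, convex, $f$-closed, $f$-bounded and weakly $f$-compact. Let $T:K\to K$ be an $f$-non-expansive mapping. Suppose that $K$ has forward normal structure and that $f$-convergence implies $b$-convergence in $X$. Then $T$ has a fixed point in $K$.
   Context: An asymmetric norm on a real vector space $X$ is a function $\Vert\cdot\vert:X\to\mathbb{R}$ such that for all $x,y\in X$ and $\lambda\ge 0$: $\Vert x\vert\ge 0$; $\Vert x\vert=\Vert -x\vert=0$ if and only if $x=0$; $\Vert\lambda x\vert=\lambda\Vert x\vert$; $\Vert x+y\vert\le\Vert x\vert+\Vert y\vert$. The pair $(X,\Vert\cdot\vert)$ is an asymmetric normed space, equipped with the asymmetric distance $d(x,y)=\Vert y-x\vert$. The forward topology $\tau^f$ is generated by the base of $f$-balls $B^f(x,r)=\{u: d(x,u)<r\}$, $x\in X$, $r>0$; ''$f$-closed'' means closed in $\tau^f$, and ''$f$-bounded'' means contained in some $f$-ball. A sequence $\{x_n\}$ $f$-converges to $x$ if $d(x,x_n)=\Vert x_n-x\vert\to 0$, and $b$-converges to $x$ if $d(x_n,x)=\Vert x-x_n\vert\to 0$. ''$f$-convergence implies $b$-convergence'' means that whenever $\{x_n\}$ $f$-converges to $x$, it also $b$-converges to $x$. A sequence $\{x_n\}$ is $f$-Cauchy if for all $\epsilon>0$ there is $N$ such that $d(x_n,x_m)<\epsilon$ whenever $m\ge n\ge N$; $X$ is $f$-Banach if every $f$-Cauchy sequence is $f$-convergent in $X$. Let $\Vert t\vert_u=\max\{t,0\}$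 on $\mathbb{R}$ (an asymmetric norm), and let $X^*$ be the set of linear maps $\varphi:(X,\Vert\cdot\vert)\to(\mathbb{R},\Vert\cdot\vert_u)$ that are continuous for the forward topologies. The weak forward topology $\tau_w^f$ on $X$ is generated by the base of sets $x+\{z\in X:\varphi_1(z)<\epsilon,\dots,\varphi_n(z)<\epsilon\}$ with $x\in X$, $\epsilon>0$, $n\in\mathbb{N}$, $\varphi_1,\dots,\varphi_n\in X^*$. A set is weakly $f$-compact if it is compact in $\tau_w^f$. A map $T:K\to K$ is $f$-non-expansive if $\Vert Ty-Tx\vert\le\Vert y-x\vert$ for all $x,y\in K$. For $H\subset X$, $\mathrm{Diam}(H)=\sup\{\Vert v-u\vert:u,v\in H\}$, and $H$ is bounded if $\mathrm{Diam}(H)<\infty$. A convex set $K$ has forward normal structure ($f$-normal structure) if every convex bounded subset $H$ of $K$ with $\mathrm{Diam}(H)>0$ contains a forward non-diametral point, i.e. there is $u\in H$ with $\sup\{\Vert v-u\vert: v\in H\}<\mathrm{Diam}(H)$. *)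

(* Defs.v *)
From HB Require Import structures.
From mathcomp Require Import all_boot all_order all_algebra.
From mathcomp Require Import all_classical all_reals all_analysis.

Set Implicit Arguments.
Unset Strict Implicit.
Unset Printing Implicit Defensive.
Import Order.TTheory GRing.Theory Num.Theory.
Import numFieldNormedType.Exports.
Local Open Scope classical_set_scope.
Local Open Scope ring_scope.

Record asymNorm (R : realType) (X : lmodType R) := AsymNorm {
  anorm :> X -> R ;
  anorm_ge0 : forall x, 0 <= anorm x ;
  anorm_eq0 : forall x, (anorm x = 0 /\ anorm (- x) = 0) <-> x = 0 ;
  anormZ : forall (l : R) x, 0 <= l -> anorm (l *: x) = l * anorm x ;
  anormD : forall x y, anorm (x + y) <= anorm x + anorm y
}.

Definition adist (R : realType) (X : lmodType R) (N : asymNorm X) (x y : X) : R :=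
  N (y - x).

Definition f_ball (R : realType) (X : lmodType R) (N : asymNorm X)
    (x : X) (r : R) : set X :=
  [set u | adist N x u < r].

Definition f_ball_base (R : realType) (X : lmodType R) (N : asymNorm X) :
    set_system X :=
  [set B | exists x r, 0 < r /\ B = f_ball N x r].

Section forward_topology.
Context {R : realType} {X : lmodType R} (N : asymNorm X).

Lemma anorm0 : N 0 = 0.
Proof. by have [_ /(_ erefl)[]] := anorm_eq0 N 0. Qed.

Lemma f_ball_base_cover : \bigcup_(B in f_ball_base N) B = setT.
Proof.
apply/seteqP; split => // x _; exists (f_ball N x 1); last first.
  by rewrite /f_ball/= /adist subrr anorm0.
by exists x, 1.
Qed.

Lemma f_ball_base_join (B C : set X) (t : X) :
  f_ball_base N B -> f_ball_base N C -> B t -> C t ->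
  exists D, [/\ f_ball_base N D, D t & D `<=` B `&` C].
Proof.
move=> [x [r [r0 ->]]] [y [s [s0 ->]]]; rewrite /f_ball /adist /= => xt yt.
exists (f_ball N t (Num.min (r - N (t - x)) (s - N (t - y)))); split.
- exists t, (Num.min (r - N (t - x)) (s - N (t - y))); split => //.
  by rewrite lt_min !subr_gt0 xt yt.
- by rewrite /f_ball /adist /= subrr anorm0 lt_min !subr_gt0 xt yt.
- move=> u; rewrite /f_ball /adist /= lt_min !ltrBrDr => /andP[ux uy].
  split; [apply: le_lt_trans ux|apply: le_lt_trans uy];
    by rewrite (le_trans _ (anormD _ _ _))// addrA subrK.
Qed.

(* A copy of X tagged with N, so that the f-topology and, below, the weak
   f-topology can both be canonical. *)
Definition fwd_space of asymNorm X : Type := X.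
HB.instance Definition _ := Choice.on (fwd_space N).
HB.instance Definition _ := @isBaseTopological.Build (fwd_space N)
  (set X) (f_ball_base N) id f_ball_base_cover f_ball_base_join.

End forward_topology.

Section upper_norm.
Variable R : realType.

Let unorm (t : R^o) : R := Num.max t 0.

Let unorm_ge0 t : 0 <= unorm t.
Proof. by rewrite le_max lexx orbT. Qed.

Let unorm_eq0 t : (unorm t = 0 /\ unorm (- t) = 0) <-> t = 0.
Proof.
split=> [[/max_idPr t0 /max_idPr]|->]; last by rewrite /unorm oppr0 maxxx.
by rewrite oppr_le0 => t0'; apply/eqP; rewrite eq_le t0 t0'.
Qed.

Let unormZ (l : R) t : 0 <= l -> unorm (l *: t) = l * unorm t.
Proof. by move=> l0; rewrite /unorm maxr_pMr// mulr0. Qed.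

Let unormD s t : unorm (s + t) <= unorm s + unorm t.
Proof.
by rewrite ge_max addr_ge0// ?unorm_ge0// lerD// le_max lexx.
Qed.

Definition upper_norm : asymNorm R^o :=
  AsymNorm unorm_ge0 unorm_eq0 unormZ unormD.

End upper_norm.

Definition fwd_continuous (R : realType) (X Y : lmodType R)
    (N : asymNorm X) (M : asymNorm Y) (f : fwd_space N -> fwd_space M) :=
  continuous f.

Definition f_dual (R : realType) (X : lmodType R) (N : asymNorm X) :
    set {linear X -> R^o} :=
  [set phi | @fwd_continuous R X R^o N (upper_norm R) phi].

(* x + {z | phi_i z < e for all i < n}; n = 0 is allowed and gives X. *)
Definition weak_f_ball (R : realType) (X : lmodType R) (x : X) (e : R)
    (n : nat) (phi : 'I_n -> {linear X -> R^o}) : set X :=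
  [set x + z | z in [set z | forall i, phi i z < e]].

Definition weak_f_ball_base (R : realType) (X : lmodType R) (N : asymNorm X) :
    set_system X :=
  [set B | exists x e n (phi : 'I_n -> {linear X -> R^o}),
    [/\ 0 < e, forall i, f_dual N (phi i) & B = weak_f_ball x e phi]].

Section weak_forward_topology.
Context {R : realType} {X : lmodType R} (N : asymNorm X).

Lemma weak_f_ballE (x y : X) (e : R) (n : nat)
    (phi : 'I_n -> {linear X -> R^o}) :
  weak_f_ball x e phi y <-> forall i, phi i (y - x) < e.
Proof.
split=> [[z /= ze <-] i|h]; first by rewrite addrC addKr.
by exists (y - x) => //; rewrite addrC subrK.
Qed.

Lemma weak_f_ball_base_cover : \bigcup_(B in weak_f_ball_base N) B = setT.
Proof.
apply/seteqP; split => // x _.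
pose phi (i : 'I_0) : {linear X -> R^o} := \0.
exists (weak_f_ball x 1 phi); last by apply/weak_f_ballE => -[].
by exists x, 1, 0, phi; split => // -[].
Qed.

Lemma weak_f_ball_base_join (B C : set X) (t : X) :
  weak_f_ball_base N B -> weak_f_ball_base N C -> B t -> C t ->
  exists D, [/\ weak_f_ball_base N D, D t & D `<=` B `&` C].
Proof.
have gap (x : X) (e : R) n (phi : 'I_n -> {linear X -> R^o}) : 0 < e ->
    weak_f_ball x e phi t ->
    exists2 d, 0 < d & forall i, phi i (t - x) + d <= e.
  move=> e0 /weak_f_ballE xt.
  exists (\big[Num.min/e]_(i < n) (e - phi i (t - x))).
    by apply: lt_bigmin => // i _; rewrite subr_gt0.
  by move=> i; rewrite -lerBrDl bigmin_le_cond.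
have split3 (x u : X) : u - x = (t - x) + (u - t).
  by rewrite [RHS]addrC addrA subrK.
move=> [x [e [n [phi [e0 phiN ->]]]]] [y [f [m [psi [f0 psiN ->]]]]] xt yt.
have [d d0 de] := gap _ _ _ _ e0 xt; have [c c0 cf] := gap _ _ _ _ f0 yt.
pose chi (i : 'I_(n + m)) :=
  match fintype.split i with inl j => phi j | inr k => psi k end.
exists (weak_f_ball t (Num.min d c) chi); split.
- exists t, (Num.min d c), (n + m)%N, chi; split => //.
    by rewrite lt_min d0 c0.
  by move=> i; rewrite /chi; case: fintype.split.
- by apply/weak_f_ballE => i; rewrite subrr linear0 lt_min d0 c0.
- move=> u /weak_f_ballE tu; split; apply/weak_f_ballE => i.
    have := tu (lshift m i); rewrite /chi (unsplitK (inl i)) lt_min => /andP[ui _].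
    apply: lt_le_trans (de i).
    by rewrite (split3 _ u) linearD ltrD2l.
  have := tu (rshift n i); rewrite /chi (unsplitK (inr i)) lt_min => /andP[_ ui].
  apply: lt_le_trans (cf i).
  by rewrite (split3 _ u) linearD ltrD2l.
Qed.

Definition weak_fwd_space of asymNorm X : Type := X.
HB.instance Definition _ := Choice.on (weak_fwd_space N).
HB.instance Definition _ := @isBaseTopological.Build (weak_fwd_space N)
  (set X) (weak_f_ball_base N) id weak_f_ball_base_cover weak_f_ball_base_join.

End weak_forward_topology.

Section notions.
Context {R : realType} {X : lmodType R} (N : asymNorm X).

Definition f_closed (K : set X) := @closed (fwd_space N) K.

Definition weakly_f_compact (K : set X) := @compact (weak_fwd_space N) K.

Definition f_bounded (K : set X) := exists x r, 0 < r /\ K `<=` f_ball N x r.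

Definition f_converges (u : nat -> X) (x : X) :=
  adist N x (u n) @[n --> \oo] --> 0.

Definition b_converges (u : nat -> X) (x : X) :=
  adist N (u n) x @[n --> \oo] --> 0.

Definition f_cauchy (u : nat -> X) :=
  forall e : R, 0 < e ->
  exists n0 : nat, forall n m : nat, (n0 <= n)%N -> (n <= m)%N ->
    adist N (u n) (u m) < e.

Definition f_Banach :=
  forall u : nat -> X, f_cauchy u -> exists x, f_converges u x.

Definition f_nonexpansive (K : set X) (T : X -> X) :=
  forall x y, K x -> K y -> N (T y - T x) <= N (y - x).

(* The supremum is -oo when H is empty, which `0 < diam H` then excludes. *)
Definition diam (H : set X) : \bar R :=
  ereal_sup [set (N (v - u))%:E | u in H & v in H].

Definition bounded_diam (H : set X) := (diam H < +oo)%E.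

Definition f_nondiametral (H : set X) (u : X) :=
  (ereal_sup [set (N (v - u))%:E | v in H] < diam H)%E.

Definition f_normal_structure (K : set X) :=
  forall H : set X, H `<=` K -> convex_set H -> bounded_diam H ->
    (0 < diam H)%E ->
  exists2 u, H u & f_nondiametral H u.

End notions.

(* Main.v *)
Require Import Defs.
From HB Require Import structures.
From mathcomp Require Import all_boot all_order all_algebra.
From mathcomp Require Import all_classical all_reals all_analysis.
From mathcomp Require Import ring lra.
Set Implicit Arguments.
Unset Strict Implicit.
Unset Printing Implicit Defensive.
Import Order.TTheory GRing.Theory Num.Theory.
Import numFieldNormedType.Exports.
Local Open Scope classical_set_scope.
Local Open Scope ring_scope.

(** The hypothesis that f-convergence implies b-convergence is quantitative by
homogeneity: it forces [N (- x) <= c * N x] for some constant [c]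
([antipode_dominated]).  Hence the f-bounded set [K] has finite diameter, and
closed balls of both orientations, [N (x - y) <= r] and [N (v - x) <= r], are
closed for the weak f-topology: by Hahn-Banach each of them is an intersection
of half-spaces [a <= phi x] with [phi] in the dual
([closed_b_ball_closed_convex], [closed_f_ball_closed_convex]).

The rest is Kirk's argument.  Weak compactness and Zorn's lemma give a minimal
non-empty convex [T]-stable subset [H] of [K] that is weakly closed in [K]
([minimal_piece]).  By minimality, a weakly closed convex set that meets [H] and
whose trace on [H] is preserved by [T] contains all of [H]
([minimal_piece_sub]).  If [diam N H] were positive, normal structure would
give [u] in [H] and [r < diam N H] with [N (v - u) <= r] for all [v] in [H].
Consider the centres [C] of radius [r], that is, the points [y] with
[N (v - y) <= r] for all [v] in [H].  For a centre [y] in [H], nonexpansiveness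
shows that the ball of centre [T y] and radius [r] contains [T v] for every [v]
in [H], so by minimality it contains [H]; in other words [T y] is again a
centre.  By minimality once more every point of [H] is a centre, hence
[diam N H <= r], a contradiction.  So [diam N H] is zero, and since [N] separates
points [H] is a singleton, whose element is fixed by [T]. *)

(** * Maximal elements in a subset of an ordered type *)

Lemma Zorn_in (T : Type) (P : set T) (R : T -> T -> Prop) :
  (forall t, R t t) -> (forall r s t, R r s -> R s t -> R r t) ->
  (forall s t, R s t -> R t s -> s = t) ->
  (forall A : set T, A `<=` P -> total_on A R ->
    exists2 t, P t & forall s, A s -> R s t) ->
  exists2 t, P t & forall s, P s -> R t s -> s = t.
Proof.
move=> Rrefl Rtrans Ranti ub.
pose Q (s t : {t | P t}) := `[< R (sval s) (sval t) >].
have [||||t tmax] := @Zorn {t | P t} Q.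
- by move=> t; apply/asboolP.
- by move=> r s t /asboolP rs /asboolP st; apply/asboolP/(Rtrans _ _ _ rs st).
- by move=> [s Ps] [t Pt] /asboolP st /asboolP ts; exact/eq_exist/Ranti.
- move=> A Atot; have [||t Pt tub] := ub [set sval s | s in A].
  + by move=> _ [s _ <-]; exact: (svalP s).
  + move=> _ _ [s As <-] [t At <-].
    by have [/asboolP|/asboolP] := Atot _ _ As At; [left|right].
  + by exists (exist _ t Pt) => s As; apply/asboolP/tub; exists s.
- exists (sval t) => [|s Ps ts]; first exact: (svalP t).
  by have /(congr1 sval) := tmax (exist _ s Ps) (asboolT ts).
Qed.

(** * The Hahn-Banach theorem for sublinear functionals *)

Section hahn_banach.
Context {R : realType} {X : lmodType R}.
Implicit Types (p q : X -> R) (x y : X).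

(** Only positive scalars and one inequality are asked for: this is what passes
to infima, and it already implies [q (t *: x) = t * q x] for [0 <= t]. *)
Definition sublinear q :=
  (forall x y, q (x + y) <= q x + q y) /\
  (forall t x, 0 < t -> q (t *: x) <= t * q x).

Lemma sublinear0 q : sublinear q -> q 0 = 0.
Proof.
move=> [_ qZ]; apply/eqP; rewrite eq_le.
have /(qZ _ 0) : 0 < 2 :> R by [].
have /(qZ _ 0) : 0 < 2^-1 :> R by [].
by rewrite !scaler0 => h1 h2; apply/andP; split; lra.
Qed.

Lemma sublinearN q x : sublinear q -> - q (- x) <= q x.
Proof.
move=> sq; have := sq.1 x (- x).
by rewrite subrr sublinear0// => h; lra.
Qed.

(** Each member is only compared with some other member of the family, so that
the lemma serves both a chain of sublinear functionals and the family
[tilts] below, whose members are not sublinear themselves. *)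
Lemma sublinear_inf (D : set (X -> R)) :
  D !=set0 -> (forall x, has_lbound [set f x | f in D]) ->
  (forall f g x y, D f -> D g -> exists2 h, D h & h (x + y) <= f x + g y) ->
  (forall f t x, D f -> 0 < t -> exists2 h, D h & h (t *: x) <= t * f x) ->
  sublinear (fun x => inf [set f x | f in D]).
Proof.
move=> [f0 Df0] lbD DD DZ.
have ge_infD x a : (forall f, D f -> a <= f x) -> a <= inf [set f x | f in D].
  by move=> h; apply: lb_le_inf => [|_ [f Df <-]]; [exists (f0 x), f0|exact: h].
have inf_leD x f : D f -> inf [set f x | f in D] <= f x.
  by move=> Df; apply: ge_inf => //; exists f.
split=> [x y|t x t0].
  rewrite -lerBlDr; apply: (ge_infD) => f Df.
  rewrite lerBlDr -lerBlDl.
  apply: (ge_infD) => g Dg; rewrite lerBlDl.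
  have [h Dh] := DD f g x y Df Dg; apply: le_trans; exact: inf_leD.
rewrite -ler_pdivrMl//; apply: (ge_infD) => f Df; rewrite ler_pdivrMl//.
have [h Dh] := DZ f t x Df t0; apply: le_trans; exact: inf_leD.
Qed.

Definition tilts q y : set (X -> R) :=
  [set fun x => q (x + t *: y) - t * q y | t in [set t | 0 <= t]].

(** [tilt q y] is the largest sublinear functional below [q] whose value at
[- y] is at most [- q y]. *)
Definition tilt q y x := inf [set f x | f in tilts q y].

Lemma tilts_lbound q x y : sublinear q ->
  lbound [set f x | f in tilts q y] (- q (- x)).
Proof.
move=> sq _ [_ [t /= t0 <-] <-].
have qty : t * q y <= q (t *: y).
  move: t0; rewrite le_eqVlt => /predU1P[<-|t0].
    by rewrite scale0r sublinear0// mul0r.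
  have := sq.2 t^-1 (t *: y); rewrite scalerA mulVf ?gt_eqF// scale1r invr_gt0.
  by move=> /(_ t0); rewrite ler_pdivlMl.
have := sq.1 (x + t *: y) (- x); rewrite addrAC subrr add0r => h; lra.
Qed.

Lemma tilt_le q x y t : sublinear q -> 0 <= t ->
  tilt q y x <= q (x + t *: y) - t * q y.
Proof.
move=> sq t0; apply: ge_inf.
  by exists (- q (- x)); exact: tilts_lbound.
by exists (fun x => q (x + t *: y) - t * q y) => //; exists t.
Qed.

Lemma tilt_sublinear q y : sublinear q -> sublinear (tilt q y).
Proof.
move=> sq; apply: sublinear_inf.
- by exists (fun x => q (x + 0 *: y) - 0 * q y); exists 0 => /=.
- by move=> x; exists (- q (- x)); exact: tilts_lbound.
- move=> _ _ x z [s /= s0 <-] [t /= t0 <-].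
  exists (fun x => q (x + (s + t) *: y) - (s + t) * q y).
    by exists (s + t) => //=; exact: addr_ge0.
  rewrite scalerDl addrACA.
  have := sq.1 (x + s *: y) (z + t *: y) => h; lra.
- move=> _ t x [s /= s0 <-] t0.
  exists (fun x => q (x + (t * s) *: y) - (t * s) * q y).
    by exists (t * s) => //=; rewrite mulr_ge0// ltW.
  by rewrite -scalerA -scalerDr mulrBr mulrA lerB// sq.2.
Qed.

(** By minimality [tilt q y] is [q] itself, and the member of
[tilts q y] of parameter [1] then gives [q x <= q (x + y) - q y]. *)
Lemma minimal_sublinear_additive q : sublinear q ->
  (forall p, sublinear p -> (forall x, p x <= q x) -> p = q) ->
  forall x y, q (x + y) = q x + q y.
Proof.
move=> sq qmin x y; apply/eqP; rewrite eq_le sq.1/= -lerBrDr.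
have /(congr1 (@^~ x)) /= <- : tilt q y = q.
  apply: qmin => [|z]; first exact: tilt_sublinear.
  by have := tilt_le z y sq (lexx 0); rewrite scale0r addr0 mul0r subr0.
by have := tilt_le x y sq ler01; rewrite scale1r mul1r.
Qed.

(** The pointwise infimum of a chain below [p] is finite because
[- p (- x) <= q x] whenever [q] is sublinear and [q <= p]. *)
Lemma exists_minimal_sublinear p : sublinear p ->
  exists2 q, sublinear q /\ (forall x, q x <= p x) &
    forall r, sublinear r -> (forall x, r x <= q x) -> r = q.
Proof.
move=> sp; pose P q := sublinear q /\ (forall x, q x <= p x).
have [||||q [sq qp] qmin] := @Zorn_in _ P (fun q r => forall x, r x <= q x).
- by move=> q x; exact: lexx.
- by move=> q r s qr rs x; exact: le_trans (rs x) (qr x).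
- by move=> q r qr rq; apply/funext => x; apply/eqP; rewrite eq_le qr rq.
- move=> A AP Atot; have [->|A0] := eqVneq A set0; first by exists p.
  move/set0P: A0 => A0; have [q0 Aq0] := A0.
  have lbA x : has_lbound [set q x | q in A].
    exists (- p (- x)) => _ [q /AP[sq qp] <-].
    by apply: le_trans (sublinearN x sq); rewrite lerN2.
  have le_q q x : A q -> inf [set q x | q in A] <= q x.
    by move=> Aq; apply: ge_inf => //; exists q.
  exists (fun x => inf [set q x | q in A]); last by move=> q Aq x; exact: le_q.
  split; last by move=> x; apply: le_trans ((AP _ Aq0).2 x); exact: le_q.
  apply: sublinear_inf => // [f g x y Af Ag|f t x Af t0]; last first.
    by exists f => //; apply: (AP _ Af).1.2.
  have [fg|gf] := Atot _ _ Af Ag.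
    by exists g => //; apply: le_trans ((AP _ Ag).1.1 x y) _; rewrite lerD2r.
  by exists f => //; apply: le_trans ((AP _ Af).1.1 x y) _; rewrite lerD2l.
- exists q => // r sr rq; apply: qmin => //; split=> // x.
  exact: le_trans (rq x) (qp x).
Qed.

Lemma additive_sublinear_linear q : sublinear q ->
  (forall x y, q (x + y) = q x + q y) ->
  exists phi : {linear X -> R^o}, forall x, phi x = q x.
Proof.
move=> sq qD.
have qN x : q (- x) = - q x.
  by apply/eqP; rewrite -addr_eq0 -qD addNr sublinear0.
have qZ t x : 0 < t -> q (t *: x) = t * q x.
  move=> t0; apply/eqP; rewrite eq_le sq.2//=.
  by rewrite -lerN2 -qN -mulrN -qN -scalerN sq.2.
have lin : linear (q : X -> R^o).
  move=> a x y; rewrite qD; congr (_ + _).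
  have [a0|a0|->] := ltgtP a 0; last by rewrite !scale0r sublinear0.
    by rewrite -[a]opprK scaleNr qN qZ ?oppr_gt0// scaleNr.
  exact: qZ.
by exists (HB.pack_for {linear X -> R^o} (q : X -> R^o)
  (GRing.isLinear.Build R X R^o *:%R q lin)).
Qed.

(** A minimal sublinear functional below [tilt p x0] is linear, lies below [p],
and is at most [- p x0] at [- x0], which forces equality at [x0]. *)
Theorem hahn_banach p x0 : sublinear p ->
  exists2 phi : {linear X -> R^o}, (forall x, phi x <= p x) & phi x0 = p x0.
Proof.
move=> sp.
have [q [sq qp] qmin] := exists_minimal_sublinear (tilt_sublinear x0 sp).
have qD := minimal_sublinear_additive sq qmin.
have [phi phiq] := additive_sublinear_linear sq qD.
have phip x : phi x <= p x.
  rewrite phiq; apply: le_trans (qp x) _.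
  by have := tilt_le x x0 sp (lexx 0); rewrite scale0r addr0 mul0r subr0.
exists phi => //; apply/eqP; rewrite eq_le phip/= -lerN2 -linearN phiq.
apply: le_trans (qp _) _.
have := tilt_le (- x0) x0 sp ler01.
by rewrite scale1r mul1r addNr sublinear0// sub0r.
Qed.

End hahn_banach.

(** * Closed convex sets of the weak forward topology *)

Section base_topologies.
Context {R : realType} {X : lmodType R} (N : asymNorm X).
Implicit Types (x : X).

Lemma anorm_sublinear : sublinear N.
Proof.
by split=> [x y|t x t0]; [exact: anormD|rewrite anormZ// ltW].
Qed.

Lemma f_ball_open x r : 0 < r -> @open (fwd_space N) (f_ball N x r).
Proof.
move=> r0; exists [set f_ball N x r]; last by rewrite bigcup_set1.
by move=> _ ->; exists x, r.
Qed.

Lemma f_open_ball A x :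
  @open (fwd_space N) A -> A x -> exists2 r, 0 < r & f_ball N x r `<=` A.
Proof.
move=> [F Fbase <-] [_ /[dup]/Fbase[y [s [s0 ->]]] Fys yx].
exists (s - N (x - y)); first by rewrite subr_gt0.
move=> u; rewrite /f_ball /adist /= ltrBrDr => xu; exists (f_ball N y s) => //.
rewrite /f_ball /adist /=; apply: le_lt_trans xu.
by apply: le_trans (anormD N _ _); rewrite addrA subrK.
Qed.

Lemma weak_f_ball_open x e n (phi : 'I_n -> {linear X -> R^o}) :
  0 < e -> (forall i, f_dual N (phi i)) ->
  @open (weak_fwd_space N) (weak_f_ball x e phi).
Proof.
move=> e0 phiN; exists [set weak_f_ball x e phi]; last by rewrite bigcup_set1.
by move=> _ ->; exists x, e, n, phi.
Qed.

End base_topologies.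

Section weakly_closed_convex.
Context {R : realType} {X : lmodType R} (N : asymNorm X).
Implicit Types (C : set X) (x y v : X) (phi : {linear X -> R^o}).

Lemma dominated_f_dual (c : R) phi : 0 < c -> (forall x, phi x <= c * N x) ->
  f_dual N phi.
Proof.
move=> c0 phic x A; rewrite !nbhsE => -[B [oB Bx] BA].
have [r r0 rB] := f_open_ball oB Bx.
exists (f_ball N x (r / c)).
  by split; [exact: (f_ball_open _ _ (divr_gt0 r0 c0))|
    rewrite /f_ball /adist /= subrr anorm0 divr_gt0].
move=> u; rewrite /f_ball /adist /= => xu; apply/BA/rB.
rewrite /f_ball /adist /= gt_max r0 andbT -linearB.
by apply: le_lt_trans (phic _) _; rewrite mulrC -ltr_pdivlMr.
Qed.

Definition weakly_closed_convex C :=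
  @closed (weak_fwd_space N) C /\ convex_set C.

(** The inequality has this direction because weak neighbourhoods bound the
functionals of the asymmetric dual from above only; closedness of
[phi x <= a] needs [- phi] in the dual. *)
Lemma halfspace_closed_convex phi a : f_dual N phi ->
  weakly_closed_convex [set x | a <= phi x].
Proof.
move=> phiN; split.
  move=> x; apply: contraPP => /= /negP; rewrite -ltNge => xa.
  move=> /(_ (weak_f_ball x (a - phi x) (fun _ : 'I_1 => phi))) [].
    apply: open_nbhs_nbhs; split; last first.
      by apply/weak_f_ballE => _; rewrite subrr linear0 subr_gt0.
    by apply: weak_f_ball_open => //; rewrite subr_gt0.
  move=> y [/= ay /weak_f_ballE/(_ ord0)].
  by rewrite linearB ltrD2r ltNge ay.
move=> x y l; rewrite !inE /= => xa ya; rewrite linearD !linearZ /=.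
have -> : a = l%:num * a + (1 - l%:num) * a by ring.
by rewrite lerD ?ler_wpM2l ?subr_ge0.
Qed.

Lemma bigcap_closed_convex (I : Type) (D : set I) (C : I -> set X) :
  (forall i, D i -> weakly_closed_convex (C i)) ->
  weakly_closed_convex (\bigcap_(i in D) C i).
Proof.
move=> DC; split; first by apply: closed_bigI => i /DC[].
move=> x y l; rewrite !inE => xC yC i Di; apply: set_mem; apply: (DC _ Di).2.
  by apply: mem_set; exact: xC.
by apply: mem_set; exact: yC.
Qed.

(** By Hahn-Banach, [N] is the pointwise maximum of the linear functionals below
it, all of which are continuous, so the ball is an intersection of
half-spaces. *)
Lemma closed_b_ball_closed_convex v r :
  weakly_closed_convex [set x | N (v - x) <= r].
Proof.
have -> : [set x | N (v - x) <= r] =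
    \bigcap_(phi in [set phi : {linear X -> R^o} | forall x, phi x <= N x])
      [set x | phi v - r <= phi x].
  apply/seteqP; split=> x /=.
    move=> xr phi phiN /=; rewrite lerBlDr -lerBlDl -linearB.
    exact: le_trans xr.
  have [phi phiN <-] := hahn_banach (v - x) (anorm_sublinear N).
  by move=> /(_ phi phiN) /=; rewrite lerBlDr -lerBlDl -linearB.
apply: bigcap_closed_convex => phi phiN.
by apply/halfspace_closed_convex/(@dominated_f_dual 1) => // x; rewrite mul1r.
Qed.

(** The half-spaces are now [phi x <= phi y + r]; they are closed because
[- phi] is continuous too, being dominated by [c * N]. *)
Lemma closed_f_ball_closed_convex (c : R) y r :
  0 < c -> (forall x, N (- x) <= c * N x) ->
  weakly_closed_convex [set x | N (x - y) <= r].
Proof.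
move=> c0 Nc.
have -> : [set x | N (x - y) <= r] =
    \bigcap_(phi in [set phi : {linear X -> R^o} | forall x, phi x <= N x])
      [set x | - r - phi y <= (\- phi) x].
  apply/seteqP; split=> x /=.
    move=> xr phi phiN /=; rewrite -opprD lerN2 -lerBlDr -linearB.
    exact: le_trans xr.
  have [phi phiN <-] := hahn_banach (x - y) (anorm_sublinear N).
  by move=> /(_ phi phiN) /=; rewrite -opprD lerN2 -lerBlDr -linearB.
apply: bigcap_closed_convex => phi phiN.
apply/halfspace_closed_convex/(dominated_f_dual c0) => x.
by rewrite /= -linearN; exact: le_trans (Nc x).
Qed.

(** If no constant works, there are points [z n] with
[n.+1 * N (z n) < N (- z n)]; rescaled so that [N (- z n) = 1], they f-converge
to [0] while their b-distance to [0] stays equal to [1]. *)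
Lemma antipode_dominated :
  (forall (u : nat -> X) (x : X), f_converges N u x -> b_converges N u x) ->
  exists2 c, 0 < c & forall x, N (- x) <= c * N x.
Proof.
move=> fb; apply: contrapT => nodom.
have /choice[z zP] : forall n, exists x, n.+1%:R * N x < N (- x).
  move=> n; apply: contrapT => no; apply: nodom; exists n.+1%:R => // x.
  by rewrite leNgt; apply/negP => h; apply: no; exists x.
have z0 n : 0 < N (- z n).
  by apply: le_lt_trans (zP n); rewrite mulr_ge0// anorm_ge0.
pose u n := (N (- z n))^-1 *: z n.
have /fb : f_converges N u 0.
  apply: (@squeeze_cvgr _ _ _ _ (cst 0) harmonic).
  - near=> n; rewrite /adist subr0 anorm_ge0 /= anormZ ?invr_ge0 ?anorm_ge0//.
    by rewrite ler_pdivrMl// ler_pdivlMr// mulrC ltW.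
  - exact: cvg_cst.
  - exact: cvg_harmonic.
have -> : b_converges N u 0 = (cst (1 : R) n @[n --> \oo] --> (0 : R)).
  rewrite /b_converges; under eq_fun do
    rewrite /adist sub0r -scalerN anormZ ?invr_ge0 ?anorm_ge0// mulVf ?gt_eqF//.
  by [].
move=> /(cvg_unique (@Rhausdorff R))/(_ (cvg_cst _))/eqP.
by rewrite eq_sym oner_eq0.
Unshelve. all: by end_near. Qed.

End weakly_closed_convex.

(** * Minimal invariant sets *)

(** Closedness in the subspace [K], in a form that needs no choice of a closed
set of the whole space with trace [A]. *)
Definition rel_closed (T : topologicalType) (K A : set T) :=
  K `&` closure A `<=` A.

(** Being a chain, [F] is the base of a filter, and every cluster point of that
filter in [K] lies in the closure of each member of [F]. *)
Lemma compact_chain_bigcap (T : topologicalType) (K : set T)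
    (F : set (set T)) :
  compact K -> F !=set0 -> total_on F subset ->
  (forall A, F A -> [/\ A !=set0, A `<=` K & rel_closed K A]) ->
  \bigcap_(A in F) A !=set0.
Proof.
move=> Kco [A0 FA0] Ftot FP.
have filterF : ProperFilter (filter_from F id).
  apply: filter_from_proper => [|A /FP[]//].
  apply: filter_from_filter => [|A B FA FB]; first by exists A0.
  have [AB|BA] := Ftot _ _ FA FB.
    by exists A => // x Ax; split=> //; exact: AB.
  by exists B => // x Bx; split=> //; exact: BA.
have [|p [Kp clp]] := Kco _ filterF.
  by exists A0 => //; have [] := FP _ FA0.
exists p => A FA; have [_ _] := FP _ FA; apply; split=> // B pB.
by apply: clp => //; exists A.
Qed.

Section invariant_pieces.
Context {R : realType} {X : lmodType R} (N : asymNorm X).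
Variables (K : set X) (T : X -> X).

Record invariant_piece (H : set X) : Prop := {
  piece_neq0 : H !=set0 ;
  piece_sub : H `<=` K ;
  piece_closed : @rel_closed (weak_fwd_space N) K H ;
  piece_convex : convex_set H ;
  piece_stable : set_fun H H T
}.

(** In Zorn's lemma the order is reverse inclusion; the intersection of a
non-empty chain of pieces is non-empty by compactness, and the empty chain is
bounded by [K]. *)
Lemma minimal_piece :
  K !=set0 -> convex_set K -> weakly_f_compact N K -> set_fun K K T ->
  exists2 H, invariant_piece H &
    forall H', invariant_piece H' -> H' `<=` H -> H' = H.
Proof.
move=> K0 Kconv Kco TK.
apply: (@Zorn_in _ invariant_piece (fun A B => B `<=` A)) => //.
- by move=> A.
- by move=> A B C BA CB; exact: subset_trans CB BA.
- by move=> A B BA AB; apply/seteqP; split.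
move=> F FP Ftot; have [->|F0] := eqVneq F set0.
  by exists K => //; split=> // x [].
exists (\bigcap_(A in F) A); last by move=> A FA; exact: bigcap_inf.
move/set0P: F0 => F0; have [A0 FA0] := F0; split.
- apply: (@compact_chain_bigcap (weak_fwd_space N) K) => //.
    by move=> A B FA FB; have [] := Ftot _ _ FA FB; [right|left].
  by move=> A /FP[].
- by move=> x /(_ _ FA0); exact: piece_sub (FP _ FA0) x.
- move=> x [Kx clx] A FA; apply: (piece_closed (FP _ FA)); split=> //.
  by apply: closure_subset clx; exact: bigcap_inf.
- move=> x y l xF yF; apply: mem_set => A FA; apply: set_mem.
  by apply: (piece_convex (FP _ FA)); apply: mem_set;
    [move/set_mem: xF|move/set_mem: yF]; apply.
- by move=> x Fx A FA; apply: (piece_stable (FP _ FA)); exact: Fx.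
Qed.

(** The trace of [C] on [H] is again a piece, hence equals [H].  Applied to a ball
that contains the image of [H], this replaces the usual identity between [H]
and the closed convex hull of its image. *)
Lemma minimal_piece_sub (H C : set X) : invariant_piece H ->
  (forall H', invariant_piece H' -> H' `<=` H -> H' = H) ->
  weakly_closed_convex N C -> H `&` C !=set0 ->
  (forall x, H x -> C x -> C (T x)) -> H `<=` C.
Proof.
move=> [_ HK Hcl Hconv HT] Hmin [Ccl Cconv] HC0 TC.
rewrite -(Hmin (H `&` C)); [exact: subIsetr| |exact: subIsetl].
split=> //.
- by move=> x [/HK].
- move=> x [Kx clx]; split.
    apply: Hcl; split=> //; apply: closure_subset clx; exact: subIsetl.
  by apply: Ccl; apply: closure_subset clx; exact: subIsetr.
- move=> x y l /set_mem[Hx Cx] /set_mem[Hy Cy]; apply: mem_set.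
  by split; apply: set_mem; [apply: Hconv|apply: Cconv]; exact: mem_set.
- by move=> x [Hx Cx]; split; [exact: HT|exact: TC].
Qed.

End invariant_pieces.

(** * Diameter *)

Section diameter.
Context {R : realType} {X : lmodType R} (N : asymNorm X).
Implicit Types H : set X.

Lemma le_diam H x y : H x -> H y -> ((N (y - x))%:E <= diam N H)%E.
Proof. by move=> Hx Hy; apply: ereal_sup_ubound; exists x => //; exists y. Qed.

Lemma f_bounded_diam (c : R) K H : 0 < c -> (forall x, N (- x) <= c * N x) ->
  f_bounded N K -> H `<=` K -> bounded_diam N H.
Proof.
move=> c0 Nc [x [r [r0 Kr]]] HK.
apply: (@le_lt_trans _ _ (r + c * r)%:E); last exact: ltry.
apply: ge_ereal_sup => _ [u /HK/Kr ur [v /HK/Kr vr <-]].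
rewrite lee_fin; rewrite /f_ball /adist /= in ur vr.
have -> : v - u = (v - x) + - (u - x) by rewrite opprB addrA subrK.
apply: le_trans (anormD _ _ _) _; apply: lerD; first exact: ltW.
by apply: le_trans (Nc _) _; rewrite ler_pM2l// ltW.
Qed.

Lemma diam_le0_eq H x y : (diam N H <= 0)%E -> H x -> H y -> x = y.
Proof.
move=> d0 Hx Hy; apply/eqP; rewrite -subr_eq0; apply/eqP/(anorm_eq0 N).
have N0 u v : H u -> H v -> N (u - v) = 0.
  move=> Hu Hv; apply/eqP; rewrite eq_le anorm_ge0 andbT.
  by rewrite -lee_fin; apply: le_trans d0; exact: le_diam.
by rewrite opprB !N0.
Qed.

End diameter.

(** * The fixed point theorem *)

Theorem theorem26 (R : realType) (X : lmodType R) (N : asymNorm X)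
    (K : set X) (T : X -> X) :
  f_Banach N ->
  K !=set0 -> convex_set K -> f_closed N K -> f_bounded N K ->
  weakly_f_compact N K ->
  set_fun K K T -> f_nonexpansive N K T ->
  f_normal_structure N K ->
  (forall (u : nat -> X) (x : X), f_converges N u x -> b_converges N u x) ->
  exists2 x, K x & T x = x.
Proof.
move=> _ K0 Kconv _ Kbd Kco TK Tne Kns fb.
have [c c0 Nc] := antipode_dominated fb.
have [H Hpiece Hmin] := minimal_piece K0 Kconv Kco TK.
have [[x Hx] HK _ Hconv TH] := Hpiece.
have [d0|d0] := leP (diam N H) 0%E.
  by exists x; [exact: HK|apply: (diam_le0_eq d0 _ Hx); exact: TH].
have Hbd := f_bounded_diam c0 Nc Kbd HK.
have [u Hu] := Kns H HK Hconv Hbd d0.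
rewrite /f_nondiametral; set s := ereal_sup _ => sH.
have s_ge v : H v -> ((N (v - u))%:E <= s)%E.
  by move=> Hv; apply: ereal_sup_ubound; exists v.
have sfin : s \is a fin_num.
  rewrite ge0_fin_numE; first exact: lt_trans sH Hbd.
  by apply: le_trans (s_ge u Hu); rewrite lee_fin anorm_ge0.
pose r := fine s.
have uC v : H v -> N (v - u) <= r.
  by move=> Hv; rewrite -lee_fin fineK// s_ge.
pose C := \bigcap_(v in H) [set x | N (v - x) <= r].
have HC : H `<=` C.
  apply: (minimal_piece_sub Hpiece Hmin).
  - by apply: bigcap_closed_convex => v _; exact: closed_b_ball_closed_convex.
  - by exists u; split.
  move=> y Hy Cy.
  (* T y is a centre: the ball of centre T y and radius r absorbs H. *)
  apply: (minimal_piece_sub Hpiece Hmin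
    (closed_f_ball_closed_convex _ _ c0 Nc)).
    exists (T u); split; first exact: TH.
    by apply: le_trans (Tne _ _ (HK _ Hy) (HK _ Hu)) _; exact: Cy.
  move=> v Hv _ /=.
  by apply: le_trans (Tne _ _ (HK _ Hy) (HK _ Hv)) _; exact: Cy.
suff : (diam N H <= s)%E by rewrite leNgt sH.
rewrite -(fineK sfin); apply: ge_ereal_sup => _ [y Hy [v Hv <-]].
by rewrite lee_fin; exact: HC.
Qed.
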